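(* Let $S_j$ be local potentials satisfying (A)–(E), let $\omega\in\mathbb{R}^d$, let $x\in\overline{\mathcal{B}}_\omega$ be a global minimizer, and let $[y^-,y^+]$ be a gap of the Aubry–Mather set $\mathcal{M}(x)$. Let $\Gamma$ be a ghost circle with $\mathcal{M}(x)\subset\Gamma$. If every configuration in $\Gamma\cap[y^-,y^+]$ is stationary, then every configuration in $\Gamma\cap[y^-,y^+]$ is a global minimizer.
   Context: Notation: $\|i\|=\sum_{k=1}^d|i_k|$, $B_j^r=\{k:\|k-j\|\le r\}$, $(\tau_{k,l}x)_i=x_{i+k}+l$. Local potentials $S_j:\mathbb{R}^{\mathbb{Z}^d}\to\mathbb{R}$, $j\in\mathbb{Z}^d$, satisfy: (A) there is $r\in(0,\infty)$ and $C^2$ functions $s_j:\mathbb{R}^{B_j^r}\to\mathbb{R}$ with $S_j(x)=s_j(x|_{B_j^r})$; (B) $S_j(\tau_{k,l}x)=S_{j+k}(x)$; (C) each $S_j$ is bounded below and $S_j(x)\to\infty$ as $|x_k-x_j|\to\infty$ whenever $\|k-j\|=1$; (D) $\partial_{i,k}S_j\le0$ for $i\ne k$, and $\partial_{i,k}S_i<0$ when $\|i-k\|=1$; (E) $|\partial_{i,k}S_j|\le C$ uniformly. Order: $x\le y$ iff $x_i\le y_i$ for all $i$; $x\ll y$ iff $x_i<y_i$ for all $i$; $[a,b]=\{z:a\le z\le b\}$. Birkhoff, rotation vector: $\tau_{k,l}x\ge x$ or $\le x$ for all $(k,l)$; $\lim_nx_{ni}/n=\langle\omega,i\rangle$. $\overline{\mathcal{B}}_\omega$: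 Birkhoff configurations of rotation vector $\omega$ with $\tau_{k,l}x=x$ whenever $\langle\omega,k\rangle+l=0$. Stationary: $\sum_{\|j-i\|\le r}\partial_iS_j(x)=0$ for all $i$. Global minimizer: $W_B(x+y)\ge W_B(x)$ for every finite $B$ and every $y$ supported in $\mathring{B}^{(r)}=\{i\in B:B_i^r\subset B\}$, $W_B=\sum_{j\in B}S_j$. $\widetilde{\mathcal{M}}(x)$ is the pointwise closure of $\{\tau_{k,l}x:(k,l)\in\mathbb{Z}^d\times\mathbb{Z}\}$. The Aubry–Mather set $\mathcal{M}(x)$ is $\widetilde{\mathcal{M}}(x)$ if $\omega\in\mathbb{Q}^d$, and if $\omega\notin\mathbb{Q}^d$ it is $\{y\in\widetilde{\mathcal{M}}(x):y=\lim_n\tau_{k_n,l_n}y\text{ pointwise for some }(k_n,l_n)\text{ with }\langle\omega,k_n\rangle+l_n\ne0\}$. A gap of $\mathcal{M}(x)$ is an order interval $[y^-,y^+]$ with $y^-,y^+\in\mathcal{M}(x)$, $y^-\ll y^+$, containing no element of $\mathcal{M}(x)$ other than $y^\pm$. $\mathbb{X}=\{x:\sum_i2^{-\|i\|}|x_i|<\infty\}$; $(\nabla W(x))_i=\sum_{\|j-i\|\le r}\partial_iS_j(x)$; $\Psi_t$ the complete flow of $\dot x=-\nabla W(x)$ on $\mathbb{X}$. A ghost circle is a set $\Gamma$ that is nonempty, closed and connected (pointwise topology), strictly ordered (for $x,y\in\Gamma$: $x\ll y$, $x=y$ or $y\ll x$), shift-invariant, with $\Psi_t(\Gamma)=\Gamma$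 for all $t$. *)

(* Defs.v *)
From Stdlib Require Import Reals Lra ZArith List Classical ClassicalEpsilon FunctionalExtensionality.
Open Scope R_scope.

Definition Zd (d : nat) := { i : nat -> Z | forall k, (d <= k)%nat -> i k = 0%Z }.
Definition idx {d} (i : Zd d) (k : nat) : Z := proj1_sig i k.

Lemma zadd_ok {d} (i j : Zd d) :
  forall k, (d <= k)%nat -> (idx i k + idx j k)%Z = 0%Z.
Proof. intros k Hk. unfold idx. rewrite (proj2_sig i k Hk), (proj2_sig j k Hk). reflexivity. Qed.
Definition zadd {d} (i j : Zd d) : Zd d := exist _ (fun k => (idx i k + idx j k)%Z) (zadd_ok i j).

Lemma zsub_ok {d} (i j : Zd d) :
  forall k, (d <= k)%nat -> (idx i k - idx j k)%Z = 0%Z.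
Proof. intros k Hk. unfold idx. rewrite (proj2_sig i k Hk), (proj2_sig j k Hk). reflexivity. Qed.
Definition zsub {d} (i j : Zd d) : Zd d := exist _ (fun k => (idx i k - idx j k)%Z) (zsub_ok i j).

Lemma zscale_ok {d} (n : nat) (i : Zd d) :
  forall k, (d <= k)%nat -> (Z.of_nat n * idx i k)%Z = 0%Z.
Proof. intros k Hk. unfold idx. rewrite (proj2_sig i k Hk). ring. Qed.
Definition zscale {d} (n : nat) (i : Zd d) : Zd d :=
  exist _ (fun k => (Z.of_nat n * idx i k)%Z) (zscale_ok n i).

Fixpoint zsumabs (f : nat -> Z) (n : nat) : Z :=
  match n with O => 0%Z | S m => (zsumabs f m + Z.abs (f m))%Z end.
Definition znorm {d} (i : Zd d) : R := IZR (zsumabs (idx i) d).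

(* <omega, i> for omega in R^d (only coordinates k < d of omega are used) *)
Fixpoint rdot (w : nat -> R) (f : nat -> Z) (n : nat) : R :=
  match n with O => 0 | S m => rdot w f m + w m * IZR (f m) end.
Definition dot {d} (w : nat -> R) (i : Zd d) : R := rdot w (idx i) d.

Definition ball {d} (j : Zd d) (r : R) : Zd d -> Prop := fun k => znorm (zsub k j) <= r.

Definition config (d : nat) := Zd d -> R.

Definition tau {d} (k : Zd d) (l : Z) (x : config d) : config d :=
  fun i => x (zadd i k) + IZR l.
Definition cle {d} (x y : config d) : Prop := forall i, x i <= y i.
Definition cll {d} (x y : config d) : Prop := forall i, x i < y i.
Definition cadd {d} (x y : config d) : config d := fun i => x i + y i.

Definition lsum {d} (f : Zd d -> R) (L : list (Zd d)) : R :=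
  fold_right (fun j acc => f j + acc) 0 L.
Definition enumerates {d} (P : Zd d -> Prop) (L : list (Zd d)) : Prop :=
  NoDup L /\ forall j, P j <-> In j L.
Definition finite_set {d} (P : Zd d -> Prop) : Prop :=
  exists L : list (Zd d), forall j, P j -> In j L.
(* sum of f over the finite set P (0 if P is not finite) *)
Definition fin_sum {d} (P : Zd d -> Prop) (f : Zd d -> R) : R :=
  match excluded_middle_informative (exists L, enumerates P L) with
  | left H => lsum f (proj1_sig (constructive_indefinite_description _ H))
  | right _ => 0
  end.

Definition upd {d} (x : config d) (i : Zd d) (t : R) : config d :=
  fun k => if excluded_middle_informative (k = i) then x k + t else x k.
Definition partial_at {d} (F : config d -> R) (i : Zd d) (x : config d) (l : R) : Prop :=
  derivable_pt_lim (fun t => F (upd x i t)) 0 l.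
(* partial_i F (x), the derivative of F in the coordinate x_i (0 if it does not exist) *)
Definition partial {d} (F : config d -> R) (i : Zd d) (x : config d) : R :=
  match excluded_middle_informative (exists l, partial_at F i x l) with
  | left H => proj1_sig (constructive_indefinite_description _ H)
  | right _ => 0
  end.
Definition partial2 {d} (F : config d -> R) (i k : Zd d) : config d -> R :=
  partial (partial F i) k.

Definition cont_coords {d} (B : Zd d -> Prop) (G : config d -> R) : Prop :=
  forall x eps, 0 < eps -> exists delta, 0 < delta /\
    forall y, (forall k, B k -> Rabs (y k - x k) < delta) -> Rabs (G y - G x) < eps.

Definition condA {d} (r : R) (S : Zd d -> config d -> R) : Prop :=
  0 < r /\ forall j,
    (* S_j(x) = s_j(x|_{B_j^r}) *)
    (forall x y, (forall k, ball j r k -> x k = y k) -> S j x = S j y) /\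
    (* s_j is C^2: first and second partials exist and are continuous *)
    (forall i x, exists l, partial_at (S j) i x l) /\
    (forall i k x, exists l, partial_at (partial (S j) i) k x l) /\
    (forall i, cont_coords (ball j r) (partial (S j) i)) /\
    (forall i k, cont_coords (ball j r) (partial2 (S j) i k)).

Definition condB {d} (S : Zd d -> config d -> R) : Prop :=
  forall j k l x, S j (tau k l x) = S (zadd j k) x.

Definition condC {d} (S : Zd d -> config d -> R) : Prop :=
  forall j, (exists m, forall x, m <= S j x) /\
    forall k, znorm (zsub k j) = 1 ->
      forall M, exists Rb, forall x, Rb < Rabs (x k - x j) -> M < S j x.

Definition condD {d} (S : Zd d -> config d -> R) : Prop :=
  (forall i k j x, i <> k -> partial2 (S j) i k x <= 0) /\
  (forall i k x, znorm (zsub i k) = 1 -> partial2 (S i) i k x < 0).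

Definition condE {d} (S : Zd d -> config d -> R) : Prop :=
  exists C, forall i k j x, Rabs (partial2 (S j) i k x) <= C.

Definition potentials {d} (r : R) (S : Zd d -> config d -> R) : Prop :=
  condA r S /\ condB S /\ condC S /\ condD S /\ condE S.

Definition birkhoff {d} (x : config d) : Prop :=
  forall k l, cle x (tau k l x) \/ cle (tau k l x) x.
Definition has_rotation {d} (w : nat -> R) (x : config d) : Prop :=
  forall i, Un_cv (fun n => x (zscale n i) / INR n) (dot w i).
Definition Bbar {d} (w : nat -> R) (x : config d) : Prop :=
  birkhoff x /\ has_rotation w x /\
  forall k l, dot w k + IZR l = 0 -> tau k l x = x.
Definition rational_vec (d : nat) (w : nat -> R) : Prop :=
  forall k, (k < d)%nat -> exists p q : Z, q <> 0%Z /\ w k = IZR p / IZR q.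

Definition gradW {d} (r : R) (S : Zd d -> config d -> R) (x : config d) : config d :=
  fun i => fin_sum (fun j => znorm (zsub j i) <= r) (fun j => partial (S j) i x).
Definition stationary {d} (r : R) (S : Zd d -> config d -> R) (x : config d) : Prop :=
  forall i, gradW r S x i = 0.
Definition WB {d} (S : Zd d -> config d -> R) (B : Zd d -> Prop) (x : config d) : R :=
  fin_sum B (fun j => S j x).
Definition global_minimizer {d} (r : R) (S : Zd d -> config d -> R) (x : config d) : Prop :=
  forall B, finite_set B -> forall y : config d,
    (forall i, y i <> 0 -> B i /\ forall k, ball i r k -> B k) ->
    WB S B (cadd x y) >= WB S B x.

Definition near {d} (F : Zd d -> Prop) (eps : R) (y z : config d) : Prop :=
  forall i, F i -> Rabs (z i - y i) < eps.
Definition in_closure {d} (A : config d -> Prop) (y : config d) : Prop :=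
  forall F, finite_set F -> forall eps, 0 < eps -> exists z, A z /\ near F eps y z.
Definition closed_set {d} (A : config d -> Prop) : Prop :=
  forall y, in_closure A y -> A y.
Definition open_set {d} (U : config d -> Prop) : Prop :=
  forall y, U y -> exists F, finite_set F /\ exists eps, 0 < eps /\
    forall z, near F eps y z -> U z.
Definition connected_set {d} (A : config d -> Prop) : Prop :=
  forall U V, open_set U -> open_set V ->
    (forall y, A y -> U y \/ V y) -> (forall y, A y -> U y -> V y -> False) ->
    (forall y, A y -> ~ U y) \/ (forall y, A y -> ~ V y).

Definition Mtilde {d} (x : config d) : config d -> Prop :=
  in_closure (fun z => exists k l, z = tau k l x).
Definition AubryMather {d} (w : nat -> R) (x : config d) (y : config d) : Prop :=
  Mtilde x y /\
  (~ rational_vec d w ->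
     exists (kn : nat -> Zd d) (ln : nat -> Z),
       (forall n, dot w (kn n) + IZR (ln n) <> 0) /\
       forall i, Un_cv (fun n => tau (kn n) (ln n) y i) (y i)).
Definition is_gap {d} (w : nat -> R) (x ym yp : config d) : Prop :=
  AubryMather w x ym /\ AubryMather w x yp /\ cll ym yp /\
  forall z, AubryMather w x z -> cle ym z -> cle z yp -> z = ym \/ z = yp.

Definition weight {d} (i : Zd d) : R := Rpower 2 (- znorm i).
Definition inX {d} (x : config d) : Prop :=
  exists M, forall L : list (Zd d), NoDup L -> lsum (fun i => weight i * Rabs (x i)) L <= M.
(* Psi is the complete flow of dx/dt = - grad W(x) on X (derivative in the norm of X) *)
Definition is_flow {d} (r : R) (S : Zd d -> config d -> R) (Psi : R -> config d -> config d) : Prop :=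
  forall x, inX x -> Psi 0 x = x /\ forall t, inX (Psi t x) /\
    forall eps, 0 < eps -> exists delta, 0 < delta /\
      forall h, h <> 0 -> Rabs h < delta ->
        forall L : list (Zd d), NoDup L ->
          lsum (fun i => weight i * Rabs ((Psi (t + h) x i - Psi t x i) / h
                                          + gradW r S (Psi t x) i)) L <= eps.

Definition ghost_circle {d} (Psi : R -> config d -> config d) (G : config d -> Prop) : Prop :=
  (exists y, G y) /\ closed_set G /\ connected_set G /\
  (forall x y, G x -> G y -> cll x y \/ x = y \/ cll y x) /\
  (forall k l y, G y -> G (tau k l y)) /\
  (forall y, G y -> inX y) /\
  (forall t, (forall y, G y -> G (Psi t y)) /\ (forall z, G z -> exists y, G y /\ Psi t y = z)).

(* Main.v *)
From Stdlib Require Import Reals Lra Lia ZArith List FinFun Classical ClassicalEpsilon FunctionalExtensionality ProofIrrelevance.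
Require Import Defs.
Open Scope R_scope.

(** Let [z] be a leaf of [Gamma] in the gap and [u] any competitor agreeing with
    [z] outside the interior of a finite [B].  The end points [ym], [yp] are limits of
    translates of a minimizer, hence minimizers, so by submodularity of [WB] truncating
    [u] to [[ym, yp]] does not increase the energy.  Let [u] therefore minimize [WB]
    among the competitors in [[ym, yp]].  If [u <= z] failed, the lowest leaf [v] above
    [u] would satisfy [z << v] and, by connectedness of [Gamma], touch [u] somewhere.
    As [v] is stationary and the energy cannot be lowered by decreasing [u] at a touching
    point, the monotonicity (D) makes all neighbours of a touching point touching points;
    following a coordinate axis one leaves [B], where [u = z << v].  The same argument
    from below gives [u = z]. *)

(** * Lattice points, norms and finiteness of balls *)

Lemma zd_ext {d} (i j : Zd d) : (forall k, idx i k = idx j k) -> i = j.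
Proof.
  destruct i as [f Hf], j as [g Hg]; unfold idx; simpl; intro H.
  assert (f = g) by (apply functional_extensionality; exact H).
  subst g. f_equal. apply proof_irrelevance.
Qed.

Lemma idx_zadd {d} (i j : Zd d) k : idx (zadd i j) k = (idx i k + idx j k)%Z.
Proof. reflexivity. Qed.

Lemma idx_zsub {d} (i j : Zd d) k : idx (zsub i j) k = (idx i k - idx j k)%Z.
Proof. reflexivity. Qed.

Ltac zd := intros; apply zd_ext; intro; rewrite ?idx_zadd, ?idx_zsub, ?idx_zadd, ?idx_zsub; try ring.

Lemma zadd_zsub {d} (i k : Zd d) : zadd (zsub i k) k = i.
Proof. zd. Qed.

Lemma zsub_zadd {d} (i k : Zd d) : zsub (zadd i k) k = i.
Proof. zd. Qed.

Lemma zsub_zsub_same {d} (i j k : Zd d) : zsub (zsub i k) (zsub j k) = zsub i j.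
Proof. zd. Qed.

Lemma zsumabs_eq f g n :
  (forall k, (k < n)%nat -> Z.abs (f k) = Z.abs (g k)) -> zsumabs f n = zsumabs g n.
Proof.
  induction n as [|n IH]; simpl; intro H; auto.
  rewrite IH, H; auto.
Qed.

Lemma zsumabs_ge0 f n : (0 <= zsumabs f n)%Z.
Proof. induction n; simpl; lia. Qed.

Lemma zsumabs_ge f n k : (k < n)%nat -> (Z.abs (f k) <= zsumabs f n)%Z.
Proof.
  induction n as [|n IH]; intro H; [lia|]; simpl.
  destruct (Nat.eq_dec k n) as [->|]; [pose proof (zsumabs_ge0 f n); lia|].
  assert (Z.abs (f k) <= zsumabs f n)%Z by (apply IH; lia). lia.
Qed.

Lemma znorm_sub_sym {d} (i j : Zd d) : znorm (zsub i j) = znorm (zsub j i).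
Proof.
  unfold znorm; f_equal; apply zsumabs_eq; intros; rewrite !idx_zsub; lia.
Qed.

Lemma znorm_sub_diag {d} (i : Zd d) : znorm (zsub i i) = 0.
Proof.
  unfold znorm.
  rewrite (zsumabs_eq _ (fun _ => 0%Z)) by (intros; rewrite idx_zsub; lia).
  induction d; simpl; auto.
  replace (zsumabs (fun _ => 0%Z) d) with 0%Z; [reflexivity|].
  clear; induction d; simpl; lia.
Qed.

(** Induction on [m] splits off the last coordinate, which takes one of the [2 * N + 1] values from
    [-N] to [N]. *)
Lemma bounded_functions_finite (N : nat) (m : nat) :
  exists L : list (nat -> Z), forall f,
    (forall k, (m <= k)%nat -> f k = 0%Z) ->
    (forall k, (k < m)%nat -> (Z.abs (f k) <= Z.of_nat N)%Z) -> In f L.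
Proof.
  induction m as [|m [L HL]].
  - exists ((fun _ => 0%Z) :: nil). intros f H _. left.
    apply functional_extensionality; intro k; rewrite H; auto; lia.
  - exists (flat_map (fun g : nat -> Z =>
       map (fun n k => if Nat.eq_dec k m then (Z.of_nat n - Z.of_nat N)%Z else g k)
           (seq 0 (2 * N + 1))) L).
    intros f H0 H1. apply in_flat_map.
    exists (fun k => if Nat.eq_dec k m then 0%Z else f k). split.
    + apply HL.
      * intros k Hk; destruct (Nat.eq_dec k m); auto; apply H0; lia.
      * intros k Hk; destruct (Nat.eq_dec k m); [lia|]; apply H1; lia.
    + apply in_map_iff. exists (Z.to_nat (f m + Z.of_nat N)).
      assert (Hm := H1 m (Nat.lt_succ_diag_r m)). split.
      * apply functional_extensionality; intro k.
        destruct (Nat.eq_dec k m); [subst; lia|reflexivity].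
      * apply in_seq; lia.
Qed.

(** The proof component is sealed by [abstract] while the function stays transparent, so that
    coordinates compute by [reflexivity]. *)
Definition zmask (d : nat) (f : nat -> Z) : Zd d.
Proof.
  exists (fun k => if le_lt_dec d k then 0%Z else f k).
  abstract (intros k Hk; destruct (le_lt_dec d k); [reflexivity|lia]).
Defined.

Lemma ball_finite {d} (j : Zd d) (r : R) : finite_set (ball j r).
Proof.
  (* Each coordinate of [zsub k j] is bounded by the norm, hence lies below [up r]. *)
  destruct (bounded_functions_finite (Z.to_nat (up r)) d) as [L HL].
  exists (map (fun f => zadd (zmask d f) j) L). intros k Hk.
  apply in_map_iff. exists (idx (zsub k j)). split.
  - apply zd_ext; intro c. rewrite idx_zadd.
    replace (idx (zmask d (idx (zsub k j))) c)
      with (if le_lt_dec d c then 0%Z else idx (zsub k j) c) by reflexivity.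
    destruct (le_lt_dec d c) as [H|H]; rewrite ?idx_zsub; [|lia].
    unfold idx; rewrite (proj2_sig k c H), (proj2_sig j c H); reflexivity.
  - apply HL.
    + intros c Hc. exact (proj2_sig (zsub k j) c Hc).
    + intros c Hc. apply Z.le_trans with (zsumabs (idx (zsub k j)) d).
      { now apply zsumabs_ge. }
      assert (IZR (zsumabs (idx (zsub k j)) d) < IZR (up r)).
      { apply Rle_lt_trans with r; [exact Hk | apply archimed]. }
      apply lt_IZR in H. lia.
Qed.

Lemma finite_enumerates {d} (P : Zd d -> Prop) :
  finite_set P -> exists L, enumerates P L.
Proof.
  intros [L HL].
  exists (nodup (fun i j => excluded_middle_informative (i = j))
            (filter (fun i => if excluded_middle_informative (P i) then true else false) L)).
  split; [apply NoDup_nodup|].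
  intro j. rewrite nodup_In, filter_In.
  destruct (excluded_middle_informative (P j)); split; auto.
  - intros [_ H]; discriminate.
Qed.

(** * Finite sums over lists of sites *)

Lemma lsum_app {d} (f : Zd d -> R) L1 L2 : lsum f (L1 ++ L2) = lsum f L1 + lsum f L2.
Proof. induction L1 as [|a L1 IH]; simpl; [lra|]. unfold lsum in *; lra. Qed.

Lemma lsum_cons {d} (f : Zd d -> R) a L : lsum f (a :: L) = f a + lsum f L.
Proof. reflexivity. Qed.

Lemma lsum_0 {d} (f : Zd d -> R) L : (forall j, In j L -> f j = 0) -> lsum f L = 0.
Proof.
  induction L as [|a L IH]; intro H; [reflexivity|].
  rewrite lsum_cons, H, IH; try lra; simpl; auto.
  intros; apply H; simpl; auto.
Qed.

(** The induction removes the entries of [L1] from [L2] one by one; what remains contributes zero.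
    This makes [fin_sum] independent of the chosen enumeration and lets vanishing terms outside a
    ball be dropped. *)
Lemma lsum_extend {d} (f : Zd d -> R) L1 : forall L2,
  NoDup L1 -> NoDup L2 -> incl L1 L2 ->
  (forall j, In j L2 -> ~ In j L1 -> f j = 0) -> lsum f L2 = lsum f L1.
Proof.
  induction L1 as [|a L1 IH]; intros L2 N1 N2 Hi Hz.
  - apply lsum_0; intros; apply Hz; auto.
  - destruct (in_split a L2 (Hi a (or_introl eq_refl))) as [A [B ->]].
    rewrite lsum_app, !lsum_cons. inversion N1; subst.
    rewrite <- (IH (A ++ B)), lsum_app; [lra| assumption | now apply NoDup_remove_1 in N2 | |].
    + intros b Hb. assert (Hb' := Hi b (or_intror Hb)).
      rewrite in_app_iff in *. simpl in Hb'. intuition. subst; contradiction.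
    + intros b Hb Hn. apply Hz.
      * rewrite in_app_iff in *; simpl; intuition.
      * intros [->|H]; [|contradiction]. now apply NoDup_remove_2 in N2.
Qed.

Lemma fin_sum_lsum {d} (P : Zd d -> Prop) L (f : Zd d -> R) :
  enumerates P L -> fin_sum P f = lsum f L.
Proof.
  intros [N H]. unfold fin_sum.
  destruct (excluded_middle_informative _) as [E|E].
  - destruct (constructive_indefinite_description _ E) as [L' [N' H']]; simpl.
    apply lsum_extend; auto.
    + intros j Hj; apply H', H, Hj.
    + intros j Hj Hn; exfalso; apply Hn, H, H', Hj.
  - exfalso; apply E; exists L; split; auto.
Qed.

Lemma lsum_le {d} (f g : Zd d -> R) L :
  (forall j, In j L -> f j <= g j) -> lsum f L <= lsum g L.
Proof.
  induction L as [|a L IH]; intro H; [simpl; lra|].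
  rewrite !lsum_cons. apply Rplus_le_compat; [|apply IH; intros]; apply H; simpl; auto.
Qed.

Lemma lsum_lt {d} (f g : Zd d -> R) L i :
  (forall j, In j L -> f j <= g j) -> In i L -> f i < g i -> lsum f L < lsum g L.
Proof.
  induction L as [|a L IH]; intros H Hi Hs; [easy|].
  rewrite !lsum_cons.
  assert (f a <= g a) by (apply H; simpl; auto).
  assert (lsum f L <= lsum g L) by (apply lsum_le; intros; apply H; simpl; auto).
  destruct Hi as [->|Hi]; [lra|].
  assert (lsum f L < lsum g L) by (apply IH; auto; intros; apply H; simpl; auto). lra.
Qed.

Lemma lsum_plus {d} (f g : Zd d -> R) L :
  lsum (fun j => f j + g j) L = lsum f L + lsum g L.
Proof. induction L; [simpl; lra|]. rewrite !lsum_cons; lra. Qed.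

Lemma lsum_map {d} (f : Zd d -> R) (h : Zd d -> Zd d) L :
  lsum f (map h L) = lsum (fun j => f (h j)) L.
Proof. induction L; [reflexivity|]. simpl map. rewrite !lsum_cons; lra. Qed.

Lemma lsum_ge0 {d} (f : Zd d -> R) L : (forall j, In j L -> 0 <= f j) -> 0 <= lsum f L.
Proof.
  intro H. rewrite <- (lsum_0 (fun _ => 0) L) by auto. now apply lsum_le.
Qed.

Lemma lsum_le_const {d} (f : Zd d -> R) c L :
  (forall j, In j L -> f j <= c) -> lsum f L <= INR (length L) * c.
Proof.
  induction L as [|a L IH]; intro H; [simpl; lra|].
  rewrite lsum_cons. simpl length. rewrite S_INR.
  assert (f a <= c) by (apply H; simpl; auto).
  assert (lsum f L <= INR (length L) * c) by (apply IH; intros; apply H; simpl; auto). lra.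
Qed.

(** * Coordinate changes, partial derivatives and the mean value theorem *)

Lemma upd_same {d} (x : config d) i t : upd x i t i = x i + t.
Proof. unfold upd; destruct (excluded_middle_informative _); congruence. Qed.

Lemma upd_other {d} (x : config d) i k t : k <> i -> upd x i t k = x k.
Proof. unfold upd; destruct (excluded_middle_informative _); congruence. Qed.

Lemma upd_0 {d} (x : config d) i : upd x i 0 = x.
Proof.
  apply functional_extensionality; intro k. unfold upd.
  destruct (excluded_middle_informative _); lra.
Qed.

Lemma upd_upd {d} (x : config d) i s t : upd (upd x i s) i t = upd x i (s + t).
Proof.
  apply functional_extensionality; intro k. unfold upd.
  destruct (excluded_middle_informative _); lra.
Qed.

Lemma upd_eq {d} (x y : config d) i t :
  y i = x i + t -> (forall k, k <> i -> y k = x k) -> y = upd x i t.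
Proof.
  intros H H'. apply functional_extensionality; intro k. unfold upd.
  destruct (excluded_middle_informative _); subst; auto.
Qed.

Definition has_partials {d} (G : config d -> R) : Prop :=
  forall i x, exists l, partial_at G i x l.

Lemma partial_spec {d} (G : config d -> R) i x :
  (exists l, partial_at G i x l) -> partial_at G i x (partial G i x).
Proof.
  intro H. unfold partial. destruct (excluded_middle_informative _) as [E|E]; [|contradiction].
  exact (proj2_sig (constructive_indefinite_description _ E)).
Qed.

Lemma partial_eq {d} (G : config d -> R) i x l : partial_at G i x l -> partial G i x = l.
Proof.
  intro H. eapply uniqueness_limite; [|exact H]. apply partial_spec; eauto.
Qed.

(** By [upd_upd], the derivative at [0] from the moved base point is the derivative at [s] along the
    same line. *)
Lemma partial_along {d} (G : config d -> R) i x s l :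
  partial_at G i (upd x i s) l -> derivable_pt_lim (fun t => G (upd x i t)) s l.
Proof.
  unfold partial_at, derivable_pt_lim. intros H eps He.
  destruct (H eps He) as [delta Hd]. exists delta. intros h Hh Hh'.
  specialize (Hd h Hh Hh'). rewrite !upd_upd in Hd.
  replace (s + (0 + h)) with (s + h) in Hd by ring.
  replace (s + 0) with s in Hd by ring. exact Hd.
Qed.

Lemma coord_mvt {d} (G : config d -> R) k x t : has_partials G ->
  exists s, Rmin 0 t <= s <= Rmax 0 t /\ G (upd x k t) - G x = partial G k (upd x k s) * t.
Proof.
  intro HG.
  assert (HD : forall s, derivable_pt_lim (fun t => G (upd x k t)) s (partial G k (upd x k s))).
  { intro s. apply partial_along, partial_spec, HG. }
  destruct (Rtotal_order 0 t) as [H|[H|H]].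
  - destruct (MVT_cor2 (fun t => G (upd x k t)) (fun s => partial G k (upd x k s)) 0 t H)
      as [c [Hc Hi]]; [intros; apply HD|].
    exists c. rewrite upd_0 in Hc. rewrite Rmin_left, Rmax_right by lra.
    split; [lra|]. rewrite Hc. ring.
  - subst t. exists 0. rewrite !upd_0, Rmin_left, Rmax_left by lra. split; lra.
  - destruct (MVT_cor2 (fun t => G (upd x k t)) (fun s => partial G k (upd x k s)) t 0 H)
      as [c [Hc Hi]]; [intros; apply HD|].
    exists c. rewrite upd_0 in Hc. rewrite Rmin_right, Rmax_left by lra.
    split; [lra|]. lra.
Qed.

(** * Estimates obtained by changing one coordinate at a time *)

Definition depends_on {d} (L : list (Zd d)) (G : config d -> R) : Prop :=
  forall u v, (forall k, In k L -> u k = v k) -> G u = G v.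

Definition in_box {d} (L : list (Zd d)) (a b w : config d) : Prop :=
  forall k, In k L -> a k <= w k <= b k.

(** Letting [L] grow by one site at a time gives a path from [u] towards [v] that moves one
    coordinate per step. *)
Definition glue {d} (L : list (Zd d)) (u v : config d) : config d :=
  fun k => if excluded_middle_informative (In k L) then v k else u k.

Lemma glue_nil {d} (u v : config d) : glue nil u v = u.
Proof.
  apply functional_extensionality; intro k; unfold glue.
  destruct (excluded_middle_informative _) as [H|H]; [destruct H|auto].
Qed.

Lemma glue_cons {d} k L (u v : config d) :
  glue (k :: L) u v = upd (glue L u v) k (v k - glue L u v k).
Proof.
  apply upd_eq.
  - unfold glue at 1; destruct (excluded_middle_informative _) as [H|H]; [lra|].
    exfalso; apply H; simpl; auto.
  - intros i Hi. unfold glue.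
    destruct (excluded_middle_informative (In i (k :: L))) as [H|H],
      (excluded_middle_informative (In i L)) as [H'|H']; auto.
    + destruct H as [H|H]; [congruence|contradiction].
    + exfalso; apply H; simpl; auto.
Qed.

Lemma glue_cases {d} L (u v : config d) k : glue L u v k = u k \/ glue L u v k = v k.
Proof. unfold glue; destruct (excluded_middle_informative _); auto. Qed.

Lemma glue_dep {d} L (G : config d -> R) u v : depends_on L G -> G (glue L u v) = G v.
Proof.
  intro H; apply H; intros k Hk; unfold glue.
  destruct (excluded_middle_informative _); [auto|contradiction].
Qed.

(** The increment telescopes along the glued configurations, and the mean value theorem bounds each
    step. Intermediate points stay in the box because it is a product of intervals. *)
Lemma lipschitz_of_partials {d} (G : config d -> R) L a b K :
  has_partials G -> depends_on L G ->
  (forall k w, In k L -> in_box L a b w -> Rabs (partial G k w) <= K) ->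
  forall u v, in_box L a b u -> in_box L a b v ->
    Rabs (G v - G u) <= K * lsum (fun k => Rabs (v k - u k)) L.
Proof.
  intros HG HL HK u v Hu Hv.
  rewrite <- (glue_dep L G u v HL).
  assert (Hgen : forall L', incl L' L ->
    Rabs (G (glue L' u v) - G u) <= K * lsum (fun k => Rabs (v k - u k)) L').
  { induction L' as [|k L' IH]; intro Hi.
    - rewrite glue_nil, Rminus_diag, Rabs_R0. simpl; lra.
    - assert (Hk : In k L) by (apply Hi; simpl; auto).
      assert (IH' := IH (fun j Hj => Hi j (or_intror Hj))).
      rewrite glue_cons, lsum_cons.
      set (w := glue L' u v) in *.
      destruct (coord_mvt G k w (v k - w k) HG) as [s [Hs E]].
      assert (Hw : w k = u k \/ w k = v k) by apply glue_cases.
      assert (HP : Rabs (partial G k (upd w k s)) <= K).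
      { apply HK; auto. intros i Hii.
        destruct (classic (i = k)) as [->|Hne].
        - rewrite upd_same. specialize (Hu k Hk); specialize (Hv k Hk).
          unfold Rmin, Rmax in Hs; destruct (Rle_dec 0 (v k - w k)); lra.
        - rewrite upd_other by auto. specialize (Hu i Hii); specialize (Hv i Hii).
          destruct (glue_cases L' u v i) as [E'|E']; fold w in E'; lra. }
      replace (G (upd w k (v k - w k)) - G u)
        with ((G (upd w k (v k - w k)) - G w) + (G w - G u)) by ring.
      eapply Rle_trans; [apply Rabs_triang|].
      rewrite Rmult_plus_distr_l. apply Rplus_le_compat; [|exact IH'].
      rewrite E, Rabs_mult.
      apply Rmult_le_compat; try apply Rabs_pos; auto.
      destruct Hw as [->| ->]; [lra|]. rewrite Rminus_diag, Rabs_R0; apply Rabs_pos. }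
  apply Hgen. intros j Hj; exact Hj.
Qed.

(** Along the glued configurations only coordinates with [u k < v k] move, and they move up, so each
    step contributes a nonpositive amount. *)
Lemma decreasing_of_partials {d} (G : config d -> R) L u v :
  has_partials G -> depends_on L G -> cle u v ->
  (forall k w, u k < v k -> partial G k w <= 0) -> G v <= G u.
Proof.
  intros HG HL Hle HP.
  rewrite <- (glue_dep L G u v HL). clear HL.
  induction L as [|k L IH]; [rewrite glue_nil; lra|].
  eapply Rle_trans; [|exact IH]. rewrite glue_cons. set (w := glue L u v) in *.
  destruct (coord_mvt G k w (v k - w k) HG) as [s [Hs E]].
  specialize (Hle k). specialize (HP k (upd w k s)).
  destruct (glue_cases L u v k) as [E'|E']; fold w in E'; rewrite E' in *.
  - destruct Hle as [Hlt|Heq].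
    + specialize (HP Hlt). nra.
    + rewrite Heq, Rminus_diag in *. lra.
  - rewrite Rminus_diag in *. lra.
Qed.

(** Coordinate [i] is raised first, which gives the strict drop; the remaining coordinates cannot
    raise [G] again. *)
Lemma strictly_decreasing_of_partials {d} (G : config d -> R) L u v i :
  has_partials G -> depends_on L G -> cle u v ->
  (forall k w, u k < v k -> partial G k w <= 0) ->
  u i < v i -> (forall w, partial G i w < 0) -> G v < G u.
Proof.
  intros HG HL Hle HP Hi Hs.
  destruct (coord_mvt G i u (v i - u i) HG) as [s [_ E]].
  assert (H := Hs (upd u i s)).
  apply Rle_lt_trans with (G (upd u i (v i - u i))); [|nra].
  apply (decreasing_of_partials G L); auto.
  - intro k. destruct (classic (k = i)) as [->|Hn]; [rewrite upd_same; lra|].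
    rewrite upd_other; auto.
  - intros k w Hk. apply HP.
    destruct (classic (k = i)) as [->|Hn]; auto. now rewrite upd_other in Hk.
Qed.

(** Condition (E) bounds second partials only, so the constant may depend on the box. *)
Definition loc_lipschitz {d} (L : list (Zd d)) (G : config d -> R) : Prop :=
  forall a b, exists K, 0 <= K /\ forall u v, in_box L a b u -> in_box L a b v ->
    Rabs (G v - G u) <= K * lsum (fun k => Rabs (v k - u k)) L.

Lemma lsum_abs_ge0 {d} (f : Zd d -> R) L : 0 <= lsum (fun k => Rabs (f k)) L.
Proof. apply lsum_ge0; intros; apply Rabs_pos. Qed.

Lemma loc_lipschitz_plus {d} L1 L2 (G1 G2 : config d -> R) :
  loc_lipschitz L1 G1 -> loc_lipschitz L2 G2 ->
  loc_lipschitz (L1 ++ L2) (fun x => G1 x + G2 x).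
Proof.
  intros H1 H2 a b.
  destruct (H1 a b) as [K1 [P1 E1]], (H2 a b) as [K2 [P2 E2]].
  exists (K1 + K2). split; [lra|]. intros u v Hu Hv.
  assert (A1 : Rabs (G1 v - G1 u) <= K1 * lsum (fun k => Rabs (v k - u k)) L1).
  { apply E1; intros k Hk; [apply Hu|apply Hv]; apply in_app_iff; auto. }
  assert (A2 : Rabs (G2 v - G2 u) <= K2 * lsum (fun k => Rabs (v k - u k)) L2).
  { apply E2; intros k Hk; [apply Hu|apply Hv]; apply in_app_iff; auto. }
  rewrite lsum_app.
  assert (Q1 := lsum_abs_ge0 (fun k => v k - u k) L1).
  assert (Q2 := lsum_abs_ge0 (fun k => v k - u k) L2).
  replace (G1 v + G2 v - (G1 u + G2 u)) with ((G1 v - G1 u) + (G2 v - G2 u)) by ring.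
  eapply Rle_trans; [apply Rabs_triang|]. simpl in *. nra.
Qed.

Lemma loc_lipschitz_continuous {d} L (G : config d -> R) u eps :
  loc_lipschitz L G -> 0 < eps -> exists delta, 0 < delta /\
    forall v, (forall k, In k L -> Rabs (v k - u k) < delta) -> Rabs (G v - G u) < eps.
Proof.
  intros HG He.
  destruct (HG (fun k => u k - 1) (fun k => u k + 1)) as [K [HK H]].
  set (N := INR (length L)). assert (HN : 0 <= N) by apply pos_INR.
  assert (Hpos : 0 < K * N + 1) by nra.
  (* The bound 1 keeps [v] in the unit box on which [K] is valid; adding 1 to [K * N] avoids a zero
     denominator. *)
  exists (Rmin 1 (eps / (K * N + 1))). split.
  { apply Rmin_pos; [lra|]. now apply Rdiv_lt_0_compat. }
  intros v Hv.
  set (dl := Rmin 1 (eps / (K * N + 1))) in *.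
  assert (Hd1 : dl <= 1) by apply Rmin_l.
  assert (Hd2 : dl <= eps / (K * N + 1)) by apply Rmin_r.
  assert (Hd0 : 0 < dl) by (apply Rmin_pos; [lra|now apply Rdiv_lt_0_compat]).
  eapply Rle_lt_trans; [apply H|].
  - intros k Hk; lra.
  - intros k Hk. assert (A := Rabs_def2 _ _ (Hv k Hk)). lra.
  - assert (lsum (fun k => Rabs (v k - u k)) L <= N * dl).
    { apply lsum_le_const. intros; apply Rlt_le; auto. }
    assert (dl * (K * N + 1) <= eps).
    { apply Rmult_le_compat_r with (r := K * N + 1) in Hd2; [|lra].
      unfold Rdiv in Hd2. rewrite Rmult_assoc, Rinv_l in Hd2; lra. }
    apply Rle_lt_trans with (K * (N * dl)); [now apply Rmult_le_compat_l|]. nra.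
Qed.

Lemma lsum_ge_term {d} (f : Zd d -> R) L i :
  (forall j, In j L -> 0 <= f j) -> In i L -> f i <= lsum f L.
Proof.
  induction L as [|a L IH]; intros H Hi; [easy|].
  rewrite lsum_cons.
  assert (0 <= lsum f L) by (apply lsum_ge0; intros; apply H; simpl; auto).
  assert (0 <= f a) by (apply H; simpl; auto).
  destruct Hi as [->|Hi]; [lra|].
  assert (f i <= lsum f L) by (apply IH; auto; intros; apply H; simpl; auto). lra.
Qed.

(** * Minimization over a finite-dimensional box *)

Definition clamp (a b t : R) : R := Rmax a (Rmin b t).

Lemma clamp_bounds a b t : a <= b -> a <= clamp a b t <= b.
Proof.
  intro H; unfold clamp, Rmax, Rmin.
  destruct (Rle_dec b t), (Rle_dec a _); lra.
Qed.

Lemma clamp_id a b t : a <= t <= b -> clamp a b t = t.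
Proof.
  intro H; unfold clamp, Rmax, Rmin.
  destruct (Rle_dec b t), (Rle_dec a _); lra.
Qed.

Lemma clamp_contract a b s t : a <= b -> Rabs (clamp a b s - clamp a b t) <= Rabs (s - t).
Proof.
  intro H; unfold clamp, Rmax, Rmin, Rabs.
  destruct (Rle_dec b t), (Rle_dec b s);
  repeat match goal with
  | |- context [Rle_dec ?x ?y] => destruct (Rle_dec x y)
  | |- context [Rcase_abs ?x] => destruct (Rcase_abs x)
  end; lra.
Qed.

(** The one-sided bound suffices because exchanging [s] and [t] gives the other side. *)
Lemma continuity_of_lipschitz (f : R -> R) K :
  0 <= K -> (forall s t, f s <= f t + K * Rabs (s - t)) -> continuity f.
Proof.
  intros HK H x eps He. exists (eps / (K + 1)). split.
  - apply Rdiv_lt_0_compat; lra.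
  - intros y [_ Hy]. simpl in *. unfold Rdist in *.
    assert (H1 := H y x). assert (H2 := H x y). rewrite Rabs_minus_sym in H2.
    apply Rmult_lt_compat_r with (r := K + 1) in Hy; [|lra].
    unfold Rdiv in Hy. rewrite Rmult_assoc, Rinv_l in Hy by lra.
    assert (P := Rabs_pos (y - x)). apply Rabs_def1; nra.
Qed.

Definition competitor {d} (M : list (Zd d)) (a b w u : config d) : Prop :=
  (forall k, ~ In k M -> u k = w k) /\ cle a u /\ cle u b.

(* Induction on the list of free coordinates: the minimum over the remaining ones
   is a Lipschitz function of the first. *)
Lemma box_minimizer {d} L (G : config d -> R) (a b : config d) :
  loc_lipschitz L G -> cle a b -> forall M w, cle a w -> cle w b ->
  exists u, competitor M a b w u /\ forall v, competitor M a b w v -> G u <= G v.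
Proof.
  intros HG Hab. destruct (HG a b) as [K [HK HL]].
  induction M as [|i M IH]; intros w Haw Hwb.
  - exists w. split; [repeat split; auto|]. intros v [Hv _].
    replace v with w; [lra|]. apply functional_extensionality; intro k. rewrite Hv; auto.
  - destruct (classic (In i M)) as [Hin|Hin].
    { destruct (IH w Haw Hwb) as [u [[U1 U2] U3]]. exists u. split.
      - split; auto. intros k Hk. apply U1. simpl in Hk; tauto.
      - intros v [V1 V2]. apply U3. split; auto. intros k Hk. apply V1.
        intros [->|H]; auto. }
    (* Coordinate [i] is prescribed by [t], clamped so that every real [t] is admissible and
       continuity can be shown on the whole line. *)
    set (wt := fun t => upd w i (clamp (a i) (b i) t - w i)).
    assert (Ewt : forall t, wt t i = clamp (a i) (b i) t)
      by (intro t; unfold wt; rewrite upd_same; lra).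
    assert (Ewt' : forall t k, k <> i -> wt t k = w k)
      by (intros t k Hk; unfold wt; now rewrite upd_other).
    assert (Hu : forall t, exists u, competitor M a b (wt t) u /\
              forall v, competitor M a b (wt t) v -> G u <= G v).
    { intro t. assert (Hc := clamp_bounds (a i) (b i) t (Hab i)).
      apply IH; intro k; destruct (classic (k = i)) as [->|Hk];
        rewrite ?Ewt, ?Ewt' by auto; try lra; auto. }
    apply choice in Hu. destruct Hu as [U HU].
    assert (EU : forall t, U t i = clamp (a i) (b i) t).
    { intro t. rewrite <- Ewt. apply HU; auto. }
    assert (Hcont : continuity (fun t => G (U t))).
    { apply continuity_of_lipschitz with (K := K * INR (length L)).
      { apply Rmult_le_pos; [auto|apply pos_INR]. }
      intros s t. destruct (HU t) as [[T1 [T2 T3]] _], (HU s) as [_ Hs].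
      assert (Hc := clamp_bounds (a i) (b i) s (Hab i)).
      (* Changing only coordinate [i] of the minimizer for [t] gives a competitor for [s], so the
         minimum at [s] exceeds the one at [t] by at most the Lipschitz cost of this change. *)
      set (v := upd (U t) i (clamp (a i) (b i) s - U t i)).
      assert (Ev : v i = clamp (a i) (b i) s) by (unfold v; rewrite upd_same; lra).
      assert (Ev' : forall k, k <> i -> v k = U t k)
        by (intros k Hk; unfold v; now rewrite upd_other).
      assert (Hv : competitor M a b (wt s) v).
      { split; [|split]; intro k; destruct (classic (k = i)) as [->|Hk];
          rewrite ?Ev, ?Ev', ?Ewt, ?Ewt' by auto; try lra; auto.
        intro HkM. rewrite T1 by auto. now apply Ewt'. }
      apply Rle_trans with (G v); [now apply Hs|].
      assert (HD : Rabs (G v - G (U t)) <= K * lsum (fun k => Rabs (v k - U t k)) L).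
      { apply HL; intros k _; split; auto; apply Hv. }
      assert (HS : lsum (fun k => Rabs (v k - U t k)) L <= INR (length L) * Rabs (s - t)).
      { apply lsum_le_const. intros k _. destruct (classic (k = i)) as [->|Hk].
        - rewrite Ev, EU. now apply clamp_contract, Hab.
        - rewrite Ev', Rminus_diag, Rabs_R0 by auto. apply Rabs_pos. }
      assert (G v - G (U t) <= Rabs (G v - G (U t))) by apply RRle_abs.
      apply Rmult_le_compat_l with (r := K) in HS; [|auto]. lra. }
    destruct (continuity_ab_min (fun t => G (U t)) (a i) (b i)) as [t0 [Ht0 _]];
      [apply Hab|intros; apply Hcont|].
    exists (U t0). destruct (HU t0) as [[T1 T2] _]. split.
    + split; auto. intros k Hk. rewrite T1; [apply Ewt'|];
        intro; apply Hk; simpl; auto.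
    + intros v [V1 [V2 V3]].
      apply Rle_trans with (G (U (v i))); [apply Ht0; split; auto|].
      apply HU. split; [|split; auto]. intros k Hk.
      destruct (classic (k = i)) as [->|Hki].
      * rewrite Ewt, clamp_id; auto.
      * rewrite Ewt' by auto. apply V1. intros [H|H]; auto.
Qed.

(** * Submodularity from nonpositive mixed partials *)

Definition cmin {d} (u v : config d) : config d := fun k => Rmin (u k) (v k).
Definition cmax {d} (u v : config d) : config d := fun k => Rmax (u k) (v k).

(** Raising [cmin u v] to [u] and raising [v] to [cmax u v] use the same coordinate increments. The
    second path runs above the first, so by the nonpositive mixed partials [G] grows along it by at
    most as much in each step. *)
Lemma submodular_of_partials {d} (G : config d -> R) L u v :
  has_partials G -> depends_on L G ->
  (forall i, has_partials (partial G i)) -> (forall i, depends_on L (partial G i)) ->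
  (forall i k w, i <> k -> partial2 G i k w <= 0) ->
  G (cmax u v) + G (cmin u v) <= G u + G v.
Proof.
  intros HG HL HG2 HL2 HP.
  enough (H : G (glue L v (cmax u v)) - G (glue L (cmin u v) u) <= G v - G (cmin u v)).
  { rewrite !glue_dep in H by auto. lra. }
  generalize L at 1 2 as L'. induction L' as [|k L' IH]; [rewrite !glue_nil; lra|].
  eapply Rle_trans; [|exact IH]. rewrite !glue_cons.
  set (w' := glue L' v (cmax u v)) in *. set (w := glue L' (cmin u v) u) in *.
  assert (Hww : cle w w').
  { intro j. unfold w, w', glue, cmax, cmin.
    destruct (excluded_middle_informative _); [apply Rmax_l|apply Rmin_r]. }
  (* If [u k <= v k] or [k] was moved before, neither path moves; otherwise both start at [v k] and
     rise by [u k - v k]. *)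
  assert (Ht : u k - w k = cmax u v k - w' k /\ (u k - w k = 0 \/ 0 < u k - w k /\ w k = w' k)).
  { unfold w, w', glue, cmax, cmin. unfold Rmax, Rmin.
    destruct (excluded_middle_informative _), (Rle_dec (u k) (v k)); split; try lra. }
  destruct Ht as [Ht Ht']. rewrite <- Ht. destruct Ht' as [Ht'|[Hpos Heq]].
  { rewrite Ht', !upd_0. lra. }
  destruct (MVT_cor2 (fun s => G (upd w' k s) - G (upd w k s))
    (fun s => partial G k (upd w' k s) - partial G k (upd w k s)) 0 (u k - w k) Hpos)
    as [c [Hc Hi]].
  { intros c _. apply (derivable_pt_lim_minus (fun s => G (upd w' k s)) (fun s => G (upd w k s)));
      apply partial_along, partial_spec, HG. }
  rewrite !upd_0 in Hc.
  (* The two points agree at [k], so only mixed partials with distinct indices enter. *)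
  assert (HD : partial G k (upd w' k c) <= partial G k (upd w k c)).
  { apply (decreasing_of_partials (partial G k) L); auto.
    - intro j. destruct (classic (j = k)) as [->|Hj];
        [rewrite !upd_same; lra|rewrite !upd_other; auto].
    - intros j z Hj. apply HP. intros <-. rewrite !upd_same in Hj. lra. }
  nra.
Qed.

(** * Potentials: finite range, local Lipschitz bounds, gradient and comparison *)

Lemma ball_enumerates {d} (j : Zd d) r : exists L, enumerates (ball j r) L.
Proof. apply finite_enumerates, ball_finite. Qed.

Lemma ball_sym {d} (i j : Zd d) r : ball i r j -> ball j r i.
Proof. unfold ball. now rewrite znorm_sub_sym. Qed.

Lemma ball_center {d} (i : Zd d) r : 0 < r -> ball i r i.
Proof. unfold ball. rewrite znorm_sub_diag. lra. Qed.

(** If two configurations agreeing on [L] had different values, continuity with that difference as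
    tolerance would make it smaller than itself. This is how the partials of [S j] are seen to have
    finite range. *)
Lemma cont_coords_depends {d} (P : Zd d -> Prop) (G : config d -> R) L :
  cont_coords P G -> (forall k, P k -> In k L) -> depends_on L G.
Proof.
  intros H HP u v Huv.
  destruct (Req_dec (G u) (G v)) as [E|E]; auto. exfalso.
  destruct (H v (Rabs (G u - G v))) as [dl [Hd Hc]].
  { apply Rabs_pos_lt; lra. }
  apply (Rlt_irrefl (Rabs (G u - G v))). apply Hc.
  intros k Hk. rewrite Huv, Rminus_diag, Rabs_R0 by auto. exact Hd.
Qed.

Section Potentials.
Context {d : nat} {r : R} {S : Zd d -> config d -> R} (HS : potentials r S).

Lemma pot_r_pos : 0 < r.
Proof. apply HS. Qed.

Lemma pot_has_partials j : has_partials (S j).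
Proof. destruct HS as [[_ HA] _]. intros i x. apply (HA j). Qed.

Lemma pot_has_partials2 j i : has_partials (partial (S j) i).
Proof. destruct HS as [[_ HA] _]. intros k x. apply (HA j). Qed.

Lemma pot_depends j L : (forall k, ball j r k -> In k L) -> depends_on L (S j).
Proof.
  destruct HS as [[_ HA] _]. intros HL u v H. apply (HA j). auto.
Qed.

Lemma pot_partial_depends j i L :
  (forall k, ball j r k -> In k L) -> depends_on L (partial (S j) i).
Proof.
  destruct HS as [[_ HA] _]. intros HL.
  apply cont_coords_depends with (ball j r); [apply (HA j)|exact HL].
Qed.

Lemma pot_partial_far j i x : ~ ball j r i -> partial (S j) i x = 0.
Proof.
  intro Hi. apply partial_eq. unfold partial_at.
  replace (fun t => S j (upd x i t)) with (fun _ : R => S j x);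
    [apply derivable_pt_lim_const|].
  apply functional_extensionality; intro t. destruct HS as [[_ HA] _].
  apply (HA j). intros k Hk. rewrite upd_other; auto. intros ->; contradiction.
Qed.

Lemma pot_partial2_le0 i k j w : i <> k -> partial2 (S j) i k w <= 0.
Proof. apply HS. Qed.

(** The Lipschitz estimate is applied twice: bounded second partials make the first partials
    Lipschitz, hence bounded on a box, and this in turn makes [S j] Lipschitz there. *)
Lemma pot_loc_lipschitz j L :
  (forall k, ball j r k -> In k L) -> loc_lipschitz L (S j).
Proof.
  intros HL a b. destruct HS as (_ & _ & _ & _ & [C HC]).
  set (K := lsum (fun i => Rabs (partial (S j) i a)) L
            + Rabs C * lsum (fun k => Rabs (b k - a k)) L).
  assert (HA0 := lsum_abs_ge0 (fun i => partial (S j) i a) L).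
  assert (HB0 := lsum_abs_ge0 (fun k => b k - a k) L).
  assert (HC0 := Rabs_pos C).
  exists K. split; [unfold K; simpl in *; nra|].
  apply lipschitz_of_partials; [apply pot_has_partials|now apply pot_depends|].
  intros i w Hi Hw.
  (* The box contains [w], so it is nonempty and its lower corner can serve as reference point. *)
  assert (Ha : in_box L a b a) by (intros k Hk; specialize (Hw k Hk); lra).
  assert (H : Rabs (partial (S j) i w - partial (S j) i a)
    <= Rabs C * lsum (fun k => Rabs (w k - a k)) L).
  { apply (lipschitz_of_partials (partial (S j) i) L a b); auto.
    - apply pot_has_partials2.
    - now apply pot_partial_depends.
    - intros k z _ _. eapply Rle_trans; [apply HC|apply RRle_abs]. }
  assert (H1 : lsum (fun k => Rabs (w k - a k)) L <= lsum (fun k => Rabs (b k - a k)) L).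
  { apply lsum_le. intros k Hk. specialize (Hw k Hk). rewrite !Rabs_pos_eq; lra. }
  assert (H2 : Rabs (partial (S j) i a) <= lsum (fun i => Rabs (partial (S j) i a)) L).
  { apply (lsum_ge_term (fun i => Rabs (partial (S j) i a))); auto.
    intros; apply Rabs_pos. }
  apply Rmult_le_compat_l with (r := Rabs C) in H1; [|auto].
  replace (partial (S j) i w) with ((partial (S j) i w - partial (S j) i a) + partial (S j) i a)
    by ring.
  eapply Rle_trans; [apply Rabs_triang|]. unfold K. lra.
Qed.

Lemma WB_enum B L x : enumerates B L -> WB S B x = lsum (fun j => S j x) L.
Proof. apply fin_sum_lsum. Qed.

Lemma WB_loc_lipschitz B : finite_set B -> exists L, loc_lipschitz L (WB S B).
Proof.
  intro HB. destruct (finite_enumerates B HB) as [LB HLB].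
  replace (WB S B) with (fun x => lsum (fun j => S j x) LB)
    by (apply functional_extensionality; intro x; now rewrite (WB_enum B LB)).
  clear HLB. induction LB as [|j LB [L IH]].
  - exists nil. intros a b. exists 0. split; [lra|]. intros.
    rewrite Rminus_diag, Rabs_R0. simpl; lra.
  - destruct (ball_enumerates j r) as [Lj [_ HLj]].
    exists (Lj ++ L). apply (loc_lipschitz_plus Lj L (S j)); auto.
    apply pot_loc_lipschitz. intros; now apply HLj.
Qed.

Lemma gradW_enum L i x : enumerates (ball i r) L ->
  gradW r S x i = lsum (fun j => partial (S j) i x) L.
Proof. apply fin_sum_lsum. Qed.

(** Only potentials centred in [ball i r] depend on coordinate [i], and that ball lies in [B], so
    the finite energy already has the full gradient component as its derivative. *)
Lemma WB_partial_at B i x : finite_set B -> (forall k, ball i r k -> B k) ->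
  partial_at (WB S B) i x (gradW r S x i).
Proof.
  intros HB Hi. destruct (finite_enumerates B HB) as [LB HLB].
  destruct (ball_enumerates i r) as [Li HLi].
  rewrite (gradW_enum Li) by auto.
  rewrite <- (lsum_extend (fun j => partial (S j) i x) Li LB).
  - replace (WB S B) with (fun x => lsum (fun j => S j x) LB)
      by (apply functional_extensionality; intro; now rewrite (WB_enum B LB)).
    clear HLB. unfold partial_at. induction LB as [|j LB IH].
    + apply (derivable_pt_lim_const 0).
    + apply (derivable_pt_lim_plus (fun t => S j (upd x i t))
               (fun t => lsum (fun j => S j (upd x i t)) LB)); [|exact IH].
      apply partial_spec, pot_has_partials.
  - apply HLi.
  - apply HLB.
  - intros k Hk. apply HLB, Hi, HLi, Hk.
  - intros j _ Hj. apply pot_partial_far. intro H. apply Hj, HLi, ball_sym, H.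
Qed.

Lemma WB_submodular B u v : finite_set B ->
  WB S B (cmax u v) + WB S B (cmin u v) <= WB S B u + WB S B v.
Proof.
  intro HB. destruct (finite_enumerates B HB) as [LB HLB].
  rewrite !(WB_enum B LB), <- !lsum_plus by auto.
  apply lsum_le. intros j _. destruct (ball_enumerates j r) as [L [_ HL]].
  assert (HL' : forall k, ball j r k -> In k L) by (intros; now apply HL).
  apply (submodular_of_partials (S j) L).
  - apply pot_has_partials.
  - now apply pot_depends.
  - apply pot_has_partials2.
  - intro; now apply pot_partial_depends.
  - intros; now apply pot_partial2_le0.
Qed.

(* The strong comparison principle: a touching point propagates to its neighbours. *)
Lemma touching_propagates u v i k :
  cle u v -> u i = v i -> gradW r S u i <= gradW r S v i ->
  znorm (zsub i k) = 1 -> u k = v k.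
Proof.
  intros Huv Hi Hg Hk. destruct (Huv k) as [Hlt|]; auto. exfalso.
  destruct (ball_enumerates i r) as [Li HLi]. rewrite !(gradW_enum Li) in Hg by auto.
  apply (Rle_not_lt _ _ Hg).
  assert (Hneq : forall j, u j < v j -> i <> j) by (intros j Hj <-; lra).
  apply lsum_lt with i.
  - intros j _. destruct (ball_enumerates j r) as [L [_ HL]].
    apply decreasing_of_partials with L; auto.
    + apply pot_has_partials2.
    + apply pot_partial_depends. intros; now apply HL.
    + intros; apply pot_partial2_le0; auto.
  - apply HLi, ball_center, pot_r_pos.
  - destruct (ball_enumerates i r) as [L [_ HL]].
    apply strictly_decreasing_of_partials with L k; auto.
    + apply pot_has_partials2.
    + apply pot_partial_depends. intros; now apply HL.
    + intros; apply pot_partial2_le0; auto.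
    + intro w. apply HS; auto.
Qed.

(** With a positive derivative a small decrease would lower the energy. Only decreases are tested,
    since a constrained minimizer may lie on the upper face of its box. *)
Lemma gradW_le0 B u i e : finite_set B -> (forall k, ball i r k -> B k) -> 0 < e ->
  (forall t, - e < t <= 0 -> WB S B u <= WB S B (upd u i t)) -> gradW r S u i <= 0.
Proof.
  intros HB Hi He H. destruct (Rle_lt_dec (gradW r S u i) 0) as [|Hpos]; auto. exfalso.
  destruct (WB_partial_at B i u HB Hi (gradW r S u i) Hpos) as [dl Hd].
  assert (Hdl := cond_pos dl).
  assert (Hm : 0 < Rmin e dl) by (apply Rmin_pos; auto).
  assert (M1 := Rmin_l e dl). assert (M2 := Rmin_r e dl).
  (* Half the smaller bound lies in both the admissible range and the range of the derivative
     estimate. *)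
  set (t := - (Rmin e dl / 2)). assert (t < 0) by (unfold t; lra).
  assert (Ht : Rabs t < dl) by (rewrite Rabs_left; unfold t; lra).
  specialize (Hd t (Rlt_not_eq _ _ H0) Ht).
  replace (0 + t) with t in Hd by ring. rewrite upd_0 in Hd.
  apply Rabs_def2 in Hd.
  assert (Hw := H t ltac:(unfold t; lra)).
  assert (HD : 0 < (WB S B (upd u i t) - WB S B u) / t) by lra.
  assert ((WB S B (upd u i t) - WB S B u) / t * t = WB S B (upd u i t) - WB S B u)
    by (field; lra).
  nra.
Qed.

(** The mirror image, for minimizers that may lie on the lower face. *)
Lemma gradW_ge0 B u i e : finite_set B -> (forall k, ball i r k -> B k) -> 0 < e ->
  (forall t, 0 <= t < e -> WB S B u <= WB S B (upd u i t)) -> 0 <= gradW r S u i.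
Proof.
  intros HB Hi He H. destruct (Rle_lt_dec 0 (gradW r S u i)) as [|Hneg]; auto. exfalso.
  assert (Hneg' : 0 < - gradW r S u i) by lra.
  destruct (WB_partial_at B i u HB Hi (- gradW r S u i) Hneg') as [dl Hd].
  assert (Hdl := cond_pos dl).
  assert (Hm : 0 < Rmin e dl) by (apply Rmin_pos; auto).
  assert (M1 := Rmin_l e dl). assert (M2 := Rmin_r e dl).
  set (t := Rmin e dl / 2). assert (0 < t) by (unfold t; lra).
  assert (Ht : Rabs t < dl) by (rewrite Rabs_pos_eq; unfold t; lra).
  specialize (Hd t (Rgt_not_eq _ _ H0) Ht).
  replace (0 + t) with t in Hd by ring. rewrite upd_0 in Hd.
  apply Rabs_def2 in Hd.
  assert (Hw := H t ltac:(unfold t; lra)).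
  assert (HD : (WB S B (upd u i t) - WB S B u) / t < 0) by lra.
  assert ((WB S B (upd u i t) - WB S B u) / t * t = WB S B (upd u i t) - WB S B u)
    by (field; lra).
  nra.
Qed.

End Potentials.

(** * Translates and limits of global minimizers *)

Lemma global_minimizer_le {d} r S (B : Zd d -> Prop) x v :
  global_minimizer r S x -> finite_set B ->
  (forall i, v i <> x i -> B i /\ forall k, ball i r k -> B k) -> WB S B x <= WB S B v.
Proof.
  intros Hx HB Hv. apply Rge_le.
  replace v with (cadd x (fun i => v i - x i)).
  - apply Hx; auto. intros i Hi. apply Hv. lra.
  - apply functional_extensionality; intro i; unfold cadd; ring.
Qed.

(** Condition (B) transfers the shift from the configuration to the site index, which translates
    [B]. *)
Lemma WB_tau {d} r S (B : Zd d -> Prop) k l x : potentials r S -> finite_set B ->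
  WB S B (tau k l x) = WB S (fun j => B (zsub j k)) x /\
  finite_set (fun j => B (zsub j k)).
Proof.
  intros HS HB. destruct (finite_enumerates B HB) as [L HL].
  assert (HL' : enumerates (fun j => B (zsub j k)) (map (fun j => zadd j k) L)).
  { destruct HL as [N H]. split.
    - apply Injective_map_NoDup; auto. intros a b Hab.
      rewrite <- (zsub_zadd a k), Hab. apply zsub_zadd.
    - intro j. rewrite in_map_iff. split.
      + intro Hj. exists (zsub j k). split; [apply zadd_zsub|now apply H].
      + intros [a [<- Ha]]. rewrite zsub_zadd. now apply H. }
  split.
  - rewrite (WB_enum B L), (WB_enum _ _ x HL'), lsum_map by auto.
    destruct HS as (_ & HB' & _). clear - HB'.
    induction L as [|a L IH]; [reflexivity|]. rewrite !lsum_cons, IH, HB'. reflexivity.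
  - exists (map (fun j => zadd j k) L). intros j Hj. now apply HL'.
Qed.

Lemma global_minimizer_tau {d} r S k l (x : config d) : potentials r S ->
  global_minimizer r S x -> global_minimizer r S (tau k l x).
Proof.
  intros HS Hx B HB y Hy.
  replace (cadd (tau k l x) y) with (tau k l (cadd x (fun i => y (zsub i k)))).
  - destruct (WB_tau r S B k l (cadd x (fun i => y (zsub i k))) HS HB) as [-> HB'].
    destruct (WB_tau r S B k l x HS HB) as [-> _].
    apply Hx; auto. intros i Hi. destruct (Hy _ Hi) as [H1 H2]. split; auto.
    intros j Hj. apply H2. unfold ball. now rewrite zsub_zsub_same.
  - apply functional_extensionality; intro i. unfold tau, cadd. rewrite zsub_zadd. ring.
Qed.

(** The energy of [B] is continuous in finitely many coordinates. If [p] strictly lowered the energy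
    of [y], it would also lower that of a nearby minimizer [z]; [e] is half the energy drop. *)
Lemma global_minimizer_closure {d} r S (A : config d -> Prop) y : potentials r S ->
  (forall z, A z -> global_minimizer r S z) -> in_closure A y -> global_minimizer r S y.
Proof.
  intros HS HA Hy B HB p Hp. apply Rle_ge.
  destruct (Rle_lt_dec (WB S B y) (WB S B (cadd y p))) as [|Hlt]; auto. exfalso.
  destruct (WB_loc_lipschitz HS B HB) as [L HL].
  set (e := (WB S B y - WB S B (cadd y p)) / 2). assert (He : 0 < e) by (unfold e; lra).
  destruct (loc_lipschitz_continuous L _ y e HL He) as [d1 [Hd1 C1]].
  destruct (loc_lipschitz_continuous L _ (cadd y p) e HL He) as [d2 [Hd2 C2]].
  destruct (Hy (fun k => In k L) (ex_intro _ L (fun j H => H)) (Rmin d1 d2))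
    as [z [Hz Hn]]; [now apply Rmin_pos|].
  assert (E1 : Rabs (WB S B z - WB S B y) < e).
  { apply C1. intros k Hk. eapply Rlt_le_trans; [now apply Hn|apply Rmin_l]. }
  assert (E2 : Rabs (WB S B (cadd z p) - WB S B (cadd y p)) < e).
  { apply C2. intros k Hk. unfold cadd.
    replace (z k + p k - (y k + p k)) with (z k - y k) by ring.
    eapply Rlt_le_trans; [now apply Hn|apply Rmin_r]. }
  assert (E3 := HA z Hz B HB p Hp).
  apply Rabs_def2 in E1. apply Rabs_def2 in E2. unfold e in *. lra.
Qed.

Lemma AubryMather_minimizer {d} r S w (x y : config d) : potentials r S ->
  global_minimizer r S x -> AubryMather w x y -> global_minimizer r S y.
Proof.
  intros HS Hx [Hy _]. eapply global_minimizer_closure; [exact HS| |exact Hy].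
  intros z (k & l & ->). now apply global_minimizer_tau.
Qed.

(** * Touching leaves in closed, connected, strictly ordered sets *)

Definition strictly_ordered {d} (A : config d -> Prop) : Prop :=
  forall x y, A x -> A y -> cll x y \/ x = y \/ cll y x.

Lemma list_positive_bound {d} (f : Zd d -> R) L :
  (forall i, In i L -> 0 < f i) -> exists e, 0 < e /\ forall i, In i L -> e <= f i.
Proof.
  induction L as [|a L IH]; intro H.
  - exists 1. split; [lra|easy].
  - destruct IH as [e [He HL]]; [intros; apply H; simpl; auto|].
    exists (Rmin (f a) e). split.
    + apply Rmin_pos; auto. apply H; simpl; auto.
    + intros i [->|Hi]; [apply Rmin_l|].
      eapply Rle_trans; [apply Rmin_r|auto].
Qed.

Lemma open_near {d} L eps (v : config d) : open_set (near (fun k => In k L) eps v).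
Proof.
  intros y Hy. exists (fun k => In k L). split; [now exists L|].
  destruct (list_positive_bound (fun i => eps - Rabs (y i - v i)) L) as [e [He H]].
  { intros i Hi. specialize (Hy i Hi). simpl in Hy; lra. }
  exists e. split; auto. intros z Hz i Hi.
  specialize (H i Hi). specialize (Hz i Hi).
  replace (z i - v i) with ((z i - y i) + (y i - v i)) by ring.
  eapply Rle_lt_trans; [apply Rabs_triang|]. lra.
Qed.

Lemma open_coord_lt {d} (i : Zd d) c : open_set (fun y : config d => y i < c).
Proof.
  intros y Hy. exists (fun k => k = i). split; [exists (i :: nil); simpl; auto|].
  exists (c - y i). split; [lra|]. intros z Hz.
  assert (H := Rabs_def2 _ _ (Hz i eq_refl)). lra.
Qed.

Lemma open_coord_gt {d} (i : Zd d) c : open_set (fun y : config d => c < y i).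
Proof.
  intros y Hy. exists (fun k => k = i). split; [exists (i :: nil); simpl; auto|].
  exists (y i - c). split; [lra|]. intros z Hz.
  assert (H := Rabs_def2 _ _ (Hz i eq_refl)). lra.
Qed.

Lemma open_union {d} (U V : config d -> Prop) :
  open_set U -> open_set V -> open_set (fun y => U y \/ V y).
Proof.
  intros HU HV y [H|H]; [destruct (HU y H) as (F & HF & e & He & K)
                        |destruct (HV y H) as (F & HF & e & He & K)];
    exists F; split; auto; exists e; split; auto.
Qed.

(** The axiom [completeness] yields suprema, so it is applied to the reflected set. *)
Lemma infimum_exists (E : R -> Prop) a :
  (exists t, E t) -> (forall t, E t -> a <= t) ->
  exists m, (forall t, E t -> m <= t) /\ forall e, 0 < e -> exists t, E t /\ t < m + e.
Proof.
  intros [t0 H0] Ha.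
  destruct (completeness (fun t => E (- t))) as [m [Hu Hl]].
  - exists (- a). intros t Ht. specialize (Ha _ Ht). lra.
  - exists (- t0). now rewrite Ropp_involutive.
  - exists (- m). split.
    + intros t Ht. assert (- t <= m) by (apply Hu; now rewrite Ropp_involutive). lra.
    + intros e He. apply NNPP; intro Hn.
      assert (m <= m - e); [|lra]. apply Hl. intros t Ht.
      apply Rnot_lt_le; intro Hlt. apply Hn. exists (- t). split; auto. lra.
Qed.

(* The infimum v of the leaves above u. If v did not touch u, connectedness would
   give leaves just below v that are still above u. *)
Lemma touching_leaf {d} (A : config d -> Prop) M u z yp i0 :
  closed_set A -> connected_set A -> strictly_ordered A ->
  A z -> A yp -> cle u yp -> (forall k, ~ In k M -> u k <= z k) -> z i0 < u i0 ->
  exists v i, A v /\ cle u v /\ cle v yp /\ cll z v /\ u i = v i.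
Proof.
  intros Hcl Hco Hord Hz Hyp Huyp HM Hi0.
  set (X := fun y => A y /\ cle u y).
  assert (Hinf : forall i, exists m, (forall y, X y -> m <= y i) /\
            forall e, 0 < e -> exists y, X y /\ y i < m + e).
  { intro i. destruct (infimum_exists (fun t => exists y, X y /\ t = y i) (u i))
      as [m [H1 H2]].
    - exists (yp i), yp. repeat split; auto.
    - intros t (y & [_ Hy] & ->). apply Hy.
    - exists m. split.
      + intros y Hy. apply H1. eauto.
      + intros e He. destruct (H2 e He) as (t & (y & Hy & ->) & Ht). eauto. }
  apply choice in Hinf. destruct Hinf as [v Hv].
  assert (Hlow : forall y, X y -> cle v y) by (intros y Hy i; now apply Hv).
  assert (Huv : cle u v).
  { intro i. apply Rnot_lt_le; intro Hlt.
    destruct (proj2 (Hv i) (u i - v i) ltac:(lra)) as (y & [_ Hy] & Hyi).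
    specialize (Hy i). lra. }
  (* A single leaf approximates all the infima on a finite list: of two leaves the lower one serves
     wherever either does. *)
  assert (HAv : A v).
  { apply Hcl. intros F [L HL] e He.
    assert (Happ : exists y, X y /\ forall i, In i L -> y i < v i + e).
    { clear HL. induction L as [|i L (y1 & [A1 U1] & H1)].
      - exists yp. repeat split; auto. easy.
      - destruct (proj2 (Hv i) e He) as (y2 & [A2 U2] & H2).
        destruct (Hord y1 y2 A1 A2) as [H|[->|H]].
        + exists y1. repeat split; auto. intros k [<-|Hk]; auto.
          specialize (H i). lra.
        + exists y2. repeat split; auto. intros k [<-|Hk]; auto.
        + exists y2. repeat split; auto. intros k [<-|Hk]; auto.
          specialize (H k). specialize (H1 k Hk). lra. }
    destruct Happ as (y & Hy & Hyi). exists y. split; [apply Hy|].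
    intros i Hi. specialize (Hyi i (HL i Hi)). specialize (Hlow y Hy i).
    rewrite Rabs_pos_eq; lra. }
  assert (Hzv : cll z v).
  { assert (Hu0 := Huv i0).
    destruct (Hord z v Hz HAv) as [H|[->|H]]; auto; [lra|]. specialize (H i0). lra. }
  enough (Ht : exists i, u i = v i).
  { destruct Ht as [i Hi]. exists v, i. repeat split; auto. apply Hlow. split; auto. }
  apply NNPP; intro Hn.
  assert (Hlt : cll u v).
  { intro i. destruct (Huv i) as [H|H]; auto. exfalso; eauto. }
  destruct (list_positive_bound (fun i => v i - u i) M) as [e1 [He1 H1]].
  { intros i _. specialize (Hlt i). lra. }
  (* A leaf within [e] of [v] stays above [u] on [M] and above [z] at [i0]. *)
  set (e := Rmin e1 (v i0 - z i0)).
  assert (He : 0 < e) by (apply Rmin_pos; auto; specialize (Hzv i0); lra).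
  assert (Hee1 : e <= e1) by apply Rmin_l.
  assert (Hee2 : e <= v i0 - z i0) by apply Rmin_r.
  (* The leaves below [v] are separated from those above or close to [v]. A leaf in both parts would
     exceed [z], hence [u] also off [M], and yet lie below the infimum [v] at [i0]. Since [z] and
     [v] are in different parts, neither part is empty, which contradicts connectedness. *)
  destruct (Hco (fun y => y i0 < v i0)
     (fun y => v i0 < y i0 \/ near (fun k => In k (i0 :: M)) e v y)) as [H|H].
  - apply open_coord_lt.
  - apply open_union; [apply open_coord_gt|apply open_near].
  - intros y Hy. destruct (Hord y v Hy HAv) as [H|[->|H]]; auto.
    right; right. intros k _. rewrite Rminus_diag, Rabs_R0. exact He.
  - intros y Hy Hy1 [Hy2|Hy2]; [lra|].
    assert (Hzy : cll z y).
    { assert (Hz0 : z i0 < y i0).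
      { assert (K := Rabs_def2 _ _ (Hy2 i0 (or_introl eq_refl))). lra. }
      destruct (Hord z y Hz Hy) as [H|[->|H]]; auto; [lra|]. specialize (H i0). lra. }
    enough (v i0 <= y i0) by lra. apply Hlow. split; auto. intro k.
    destruct (classic (In k M)) as [Hk|Hk].
    + assert (K := Rabs_def2 _ _ (Hy2 k (or_intror Hk))). specialize (H1 k Hk). simpl in H1. lra.
    + specialize (HM k Hk). specialize (Hzy k). lra.
  - exact (H z Hz (Hzv i0)).
  - apply (H v HAv). right. intros k _. rewrite Rminus_diag, Rabs_R0. exact He.
Qed.

(** * Reflection, which exchanges above and below *)

Definition cneg {d} (x : config d) : config d := fun k => - x k.

Lemma cneg_cneg {d} (x : config d) : cneg (cneg x) = x.
Proof. apply functional_extensionality; intro k; unfold cneg; ring. Qed.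

Lemma near_cneg {d} F eps (y z : config d) : near F eps y z -> near F eps (cneg y) (cneg z).
Proof.
  intros H i Hi. unfold cneg. replace (- z i - - y i) with (- (z i - y i)) by ring.
  rewrite Rabs_Ropp. now apply H.
Qed.

Lemma open_cneg {d} (U : config d -> Prop) : open_set U -> open_set (fun y => U (cneg y)).
Proof.
  intros HU y Hy. destruct (HU _ Hy) as (F & HF & e & He & H).
  exists F; split; auto; exists e; split; auto.
  intros z Hz. now apply H, near_cneg.
Qed.

Lemma closed_cneg {d} (A : config d -> Prop) : closed_set A -> closed_set (fun y => A (cneg y)).
Proof.
  intros HA y Hy. apply HA. intros F HF e He.
  destruct (Hy F HF e He) as (z & Hz & Hn). exists (cneg z). split; auto.
  now apply near_cneg.
Qed.

Lemma connected_cneg {d} (A : config d -> Prop) :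
  connected_set A -> connected_set (fun y => A (cneg y)).
Proof.
  intros HA U V HU HV Hc Hd.
  destruct (HA (fun y => U (cneg y)) (fun y => V (cneg y))) as [H|H].
  - now apply open_cneg.
  - now apply open_cneg.
  - intros y Hy. apply Hc. now rewrite cneg_cneg.
  - intros y Hy. apply Hd. now rewrite cneg_cneg.
  - left. intros y Hy HUy. apply (H _ Hy). now rewrite cneg_cneg.
  - right. intros y Hy HVy. apply (H _ Hy). now rewrite cneg_cneg.
Qed.

(** Negation reverses the order and preserves the hypotheses on [A], so this is [touching_leaf] for
    the reflected data. *)
Lemma touching_leaf_below {d} (A : config d -> Prop) M u z ym i0 :
  closed_set A -> connected_set A -> strictly_ordered A ->
  A z -> A ym -> cle ym u -> (forall k, ~ In k M -> z k <= u k) -> u i0 < z i0 ->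
  exists v i, A v /\ cle v u /\ cle ym v /\ cll v z /\ u i = v i.
Proof.
  intros Hcl Hco Hord Hz Hym Hu HM Hi0.
  destruct (touching_leaf (fun y => A (cneg y)) M (cneg u) (cneg z) (cneg ym) i0)
    as (v & i & Hv & H1 & H2 & H3 & H4).
  - now apply closed_cneg.
  - now apply connected_cneg.
  - intros x y Hx Hy. destruct (Hord _ _ Hx Hy) as [H|[H|H]].
    + right; right. intro k. specialize (H k). unfold cneg in H. lra.
    + right; left. rewrite <- (cneg_cneg x), H. apply cneg_cneg.
    + left. intro k. specialize (H k). unfold cneg in H. lra.
  - now rewrite cneg_cneg.
  - now rewrite cneg_cneg.
  - intro k. specialize (Hu k). unfold cneg. lra.
  - intros k Hk. specialize (HM k Hk). unfold cneg. lra.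
  - unfold cneg. lra.
  - exists (cneg v), i. unfold cneg in *.
    repeat split; auto; try (intro k; specialize (H1 k); specialize (H2 k); specialize (H3 k); lra).
    lra.
Qed.

(** * Propagation of touching points along an axis *)

Definition unit_vec d : Zd d := zmask d (fun k => if Nat.eq_dec k 0 then 1%Z else 0%Z).

(** Positive dimension matters: for [d = 0] the mask turns [unit_vec] into zero. *)
Lemma znorm_unit_step {d} (i : Zd d) : (0 < d)%nat -> znorm (zsub i (zadd i (unit_vec d))) = 1.
Proof.
  intro Hd. unfold znorm. change 1 with (IZR 1). f_equal.
  rewrite (zsumabs_eq _ (fun k => if Nat.eq_dec k 0 then 1%Z else 0%Z)).
  - clear i. destruct d as [|d]; [lia|]. clear Hd.
    induction d as [|d IH]; [reflexivity|].
    change (zsumabs (fun k => if Nat.eq_dec k 0 then 1%Z else 0%Z) (S d) + 0 = 1)%Z. lia.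
  - intros k Hk. rewrite idx_zsub, idx_zadd.
    replace (idx (unit_vec d) k) with (if le_lt_dec d k then 0%Z
      else if Nat.eq_dec k 0 then 1%Z else 0%Z) by reflexivity.
    destruct (le_lt_dec d k); [lia|]. destruct (Nat.eq_dec k 0); lia.
Qed.

(* Touching points propagate along a coordinate axis, out of the finite set M. *)
Lemma no_confined_touching {d} r S M (u v : config d) i :
  potentials r S -> (0 < d)%nat -> cle u v -> u i = v i ->
  (forall k, u k = v k -> In k M /\ gradW r S u k <= gradW r S v k) -> False.
Proof.
  intros HS Hd Huv Hi HM.
  set (p := fun n => Nat.iter n (fun j => zadd j (unit_vec d)) i).
  assert (Hp : forall n, u (p n) = v (p n)).
  { induction n as [|n IH]; auto.
    apply (touching_propagates HS u v (p n)); auto; [apply HM, IH|].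
    now apply znorm_unit_step. }
  assert (Hidx : forall n, idx (p n) 0 = (idx i 0 + Z.of_nat n)%Z).
  { induction n as [|n IH]; [simpl; lia|].
    change (p (Datatypes.S n)) with (zadd (p n) (unit_vec d)).
    rewrite idx_zadd, IH.
    replace (idx (unit_vec d) 0) with (if le_lt_dec d 0 then 0%Z else 1%Z) by reflexivity.
    destruct (le_lt_dec d 0); lia. }
  assert (HB : exists N, forall k, In k M -> (idx k 0 <= N)%Z).
  { clear. induction M as [|a M [N HN]]; [exists 0%Z; easy|].
    exists (Z.max N (idx a 0)). intros k [->|Hk]; [lia|]. specialize (HN k Hk). lia. }
  destruct HB as [N HN].
  (* After this many steps the first coordinate is at least [N + 1], beyond every site of [M]. *)
  set (n := Z.to_nat (N - idx i 0 + 1)).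
  destruct (HM _ (Hp n)) as [H _]. apply HN in H. rewrite Hidx in H. unfold n in H. lia.
Qed.

(** * Minimality of the leaves in the gap *)

Lemma competitor_upd {d} M (a b w u : config d) i t :
  competitor M a b w u -> In i M -> a i <= u i + t <= b i -> competitor M a b w (upd u i t).
Proof.
  intros (H1 & H2 & H3) Hi Ht. split; [|split]; intro k;
    destruct (classic (k = i)) as [->|Hk]; rewrite ?upd_same, ?upd_other by auto;
    auto; try tauto; lra.
Qed.

Section Foliation.
Context {d : nat} {r : R} {S : Zd d -> config d -> R} (HS : potentials r S).
Context {A : config d -> Prop} {ym yp z : config d}.
Hypothesis Hcl : closed_set A.
Hypothesis Hco : connected_set A.
Hypothesis Hord : strictly_ordered A.
Hypothesis Hym : A ym.
Hypothesis Hyp : A yp.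
Hypothesis Hz : A z.
Hypothesis Hmz : cle ym z.
Hypothesis Hzp : cle z yp.
Hypothesis Hstat : forall v, A v -> cle ym v -> cle v yp -> stationary r S v.

(** A deviation of [u] from [z] at one site [i0] already yields a leaf on that side of [z] touching
    [u]. The sites of [M] are interior to [B], so [gradW] is the derivative of the energy there. *)
Lemma constrained_minimizer_is_leaf B M u : (0 < d)%nat -> finite_set B ->
  (forall i, In i M -> forall k, ball i r k -> B k) ->
  competitor M ym yp z u ->
  (forall v, competitor M ym yp z v -> WB S B u <= WB S B v) -> u = z.
Proof.
  intros Hd HB HM Hu Hmin. destruct (Hu) as (U1 & U2 & U3).
  apply functional_extensionality; intro i0.
  destruct (Rtotal_order (u i0) (z i0)) as [Hlt|[|Hlt]]; auto; exfalso.
  - destruct (touching_leaf_below A M u z ym i0) as (v & i & V1 & V2 & V3 & V4 & V5); auto.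
    { intros k Hk. rewrite U1; auto; lra. }
    apply (no_confined_touching r S M v u i); auto.
    intros k Hk. specialize (V4 k).
    (* Off [M], [u] equals [z], which is strictly above [v], so touching occurs only in [M]. *)
    assert (HkM : In k M).
    { apply NNPP; intro Hn. rewrite U1 in Hk by auto. lra. }
    split; auto. rewrite (Hstat v V1); auto.
    (* Since [u k = v k < z k <= yp k], there is room to raise [u k] inside the box. *)
    + apply (gradW_ge0 HS B u k (yp k - u k)); auto.
      * now apply HM.
      * specialize (Hzp k). lra.
      * intros t Ht. apply Hmin, competitor_upd; auto. specialize (U2 k). lra.
    + intro j. specialize (V2 j). specialize (U3 j). lra.
  - destruct (touching_leaf A M u z yp i0) as (v & i & V1 & V2 & V3 & V4 & V5); auto.
    { intros k Hk. rewrite U1; auto; lra. }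
    apply (no_confined_touching r S M u v i); auto.
    intros k Hk. specialize (V4 k).
    assert (HkM : In k M).
    { apply NNPP; intro Hn. rewrite U1 in Hk by auto. lra. }
    split; auto. rewrite (Hstat v V1); auto.
    (* Dually, [u k = v k > z k >= ym k] leaves room to lower [u k]. *)
    + apply (gradW_le0 HS B u k (u k - ym k)); auto.
      * now apply HM.
      * specialize (Hmz k). lra.
      * intros t Ht. apply Hmin, competitor_upd; auto. specialize (U3 k). lra.
    + intro j. specialize (V2 j). specialize (U2 j). lra.
Qed.

Lemma leaf_minimizer_pos_dim : (0 < d)%nat ->
  global_minimizer r S ym -> global_minimizer r S yp -> global_minimizer r S z.
Proof.
  intros Hd Gym Gyp B HB y Hy. apply Rle_ge.
  destruct (finite_enumerates (fun i => B i /\ forall k, ball i r k -> B k)) as [M [_ HM]].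
  { destruct HB as [L HL]. exists L. intros j [Hj _]; auto. }
  set (u0 := cadd z y).
  assert (Hu0 : forall i, ~ In i M -> u0 i = z i).
  { intros i Hi. unfold u0, cadd. destruct (Req_dec (y i) 0) as [->|Hn]; [ring|].
    exfalso; apply Hi, HM, Hy, Hn. }
  (* Truncation to [ym, yp] does not increase the energy, since ym and yp are minimizers. *)
  assert (H1 : WB S B (cmin yp u0) <= WB S B u0).
  { assert (Hs := WB_submodular HS B yp u0 HB).
    assert (WB S B yp <= WB S B (cmax yp u0)); [|lra].
    apply (global_minimizer_le r); auto. intros i Hi. apply HM, NNPP. intro Hn. apply Hi.
    unfold cmax. rewrite Hu0 by auto. apply Rmax_left, Hzp. }
  assert (H2 : WB S B (cmax ym (cmin yp u0)) <= WB S B (cmin yp u0)).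
  { assert (Hs := WB_submodular HS B ym (cmin yp u0) HB).
    assert (WB S B ym <= WB S B (cmin ym (cmin yp u0))); [|lra].
    apply (global_minimizer_le r); auto. intros i Hi. apply HM, NNPP. intro Hn. apply Hi.
    unfold cmin. rewrite Hu0, (Rmin_right (yp i)) by auto. apply Rmin_left, Hmz. }
  destruct (WB_loc_lipschitz HS B HB) as [L HL].
  assert (Hmp : cle ym yp) by (intro k; eapply Rle_trans; [apply Hmz|apply Hzp]).
  destruct (box_minimizer L (WB S B) ym yp HL Hmp M z Hmz Hzp) as [u [Hu Hmin]].
  assert (u = z) as ->.
  { apply (constrained_minimizer_is_leaf B M); auto. intros i Hi. now apply HM. }
  (* The truncated perturbation competes in the box problem solved by [z], which closes the chain of
     inequalities. *)
  assert (H3 : WB S B z <= WB S B (cmax ym (cmin yp u0))); [|lra].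
  apply Hmin. unfold cmax, cmin. split; [|split]; intro k.
  - intro Hk. rewrite Hu0, (Rmin_right (yp k)), Rmax_right by auto. reflexivity.
  - apply Rmax_l.
  - apply Rmax_lub; [apply Hmp|apply Rmin_l].
Qed.

(* In dimension 0 there is no boundary to reach; instead A contains the whole segment
   from ym to z, along which the potential is constant. *)
Lemma leaf_minimizer_dim0 : d = 0%nat -> global_minimizer r S ym -> global_minimizer r S z.
Proof.
  intros Hd Gym B HB y Hy. apply Rle_ge.
  destruct (classic (exists i, y i <> 0)) as [[i Hi]|Hn].
  2:{ replace (cadd z y) with z; [lra|]. apply functional_extensionality; intro i.
      unfold cadd. destruct (Req_dec (y i) 0) as [->|Hi]; [ring|]. exfalso; eauto. }
  assert (Huniq : forall k, k = i).
  { intro k. apply zd_ext; intro c. unfold idx.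
    rewrite (proj2_sig k c), (proj2_sig i c); auto; lia. }
  assert (Hcfg : forall a b : config d, a i = b i -> a = b).
  { intros a b Hab. apply functional_extensionality; intro k. now rewrite (Huniq k). }
  destruct (Hy i Hi) as [HBi Hint].
  (* The single site is interior to [B], so [ym] has at most the energy of any configuration; it
     remains to compare [z] with [ym]. *)
  apply Rle_trans with (WB S B ym).
  2:{ apply (global_minimizer_le r); auto. intros k _. now rewrite (Huniq k). }
  set (t := z i - ym i). assert (Ht : 0 <= t) by (specialize (Hmz i); unfold t; lra).
  assert (Ez : upd ym i t = z) by (apply Hcfg; rewrite upd_same; unfold t; ring).
  destruct (coord_mvt (WB S B) i ym t) as [s [Hs E]].
  { intros k w. rewrite (Huniq k). exists (gradW r S w i). now apply WB_partial_at. }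
  rewrite Rmin_left, Rmax_right in Hs by auto.
  assert (Es := upd_same ym i s). set (w := upd ym i s) in *.
  (* If the mean value point were missing from [A], its value at the only site would separate [ym]
     from [z]. *)
  assert (Hw : A w).
  { apply NNPP; intro Hn.
    destruct (Hco (fun v => v i < w i) (fun v => w i < v i)) as [H|H].
    - apply open_coord_lt.
    - apply open_coord_gt.
    - intros v Hv. destruct (Rtotal_order (v i) (w i)) as [|[H|]]; auto.
      apply Hcfg in H. congruence.
    - intros v _ H1 H2; lra.
    - apply (H ym Hym). destruct (Req_dec s 0) as [->|]; [|lra].
      exfalso; apply Hn. unfold w. now rewrite upd_0.
    - apply (H z Hz). destruct (Req_dec s t) as [->|]; [|unfold t in *; lra].
      exfalso; apply Hn. unfold w. now rewrite Ez. }
  rewrite Ez, (partial_eq _ _ _ _ (WB_partial_at HS B i w HB Hint)) in E.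
  assert (Hst : stationary r S w).
  { apply Hstat; auto; intro k; rewrite (Huniq k), Es; [lra|].
    specialize (Hzp i). unfold t in *. lra. }
  rewrite (Hst i) in E. lra.
Qed.

End Foliation.

(** * Minimality of the gap's end points and the two cases of the dimension *)

Theorem mainTheorem19 (d : nat) (r : R) (S : Zd d -> config d -> R)
  (HS : potentials r S) (omega : nat -> R) (x : config d)
  (Hx : Bbar omega x) (Hmin : global_minimizer r S x)
  (ym yp : config d) (Hgap : is_gap omega x ym yp)
  (Psi : R -> config d -> config d) (HPsi : is_flow r S Psi)
  (Gamma : config d -> Prop) (HG : ghost_circle Psi Gamma)
  (HMG : forall y, AubryMather omega x y -> Gamma y)
  (Hstat : forall z, Gamma z -> cle ym z -> cle z yp -> stationary r S z) :
  forall z, Gamma z -> cle ym z -> cle z yp -> global_minimizer r S z.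
Proof.
  intros z Hz Hmz Hzp.
  destruct Hgap as (Am & Ap & _ & _). destruct HG as (_ & Hcl & Hco & Hord & _).
  assert (Gym := AubryMather_minimizer r S omega x ym HS Hmin Am).
  assert (Gyp := AubryMather_minimizer r S omega x yp HS Hmin Ap).
  (* Leaving a finite set by unit steps requires [0 < d], so dimension 0 is treated separately. *)
  destruct (Nat.eq_dec d 0) as [Hd|Hd].
  - exact (leaf_minimizer_dim0 HS Hco (HMG _ Am) Hz Hmz Hzp Hstat Hd Gym).
  - apply (leaf_minimizer_pos_dim HS Hcl Hco Hord (HMG _ Am) (HMG _ Ap) Hz Hmz Hzp Hstat); auto.
    lia.
Qed.
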